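(* Let $\Omega\subseteq\mathbb{R}^n$ be a nonempty, open, bounded set. There exists a constant $c>0$, depending only on $n$ and $\Omega$, such that for every smooth function $u:\Omega\to\mathbb{R}$ satisfying $\Delta u\geq 1$ on $\Omega$ and every $1\leq p\leq\infty$, $$\|u\|_{L^p(\Omega)}\cdot\left|\{x\in\Omega:|u(x)|\geq c\}\right|^{1/p'}\geq c,$$ where $p'$ is the conjugate exponent, $1/p+1/p'=1$. In particular $c$ does not depend on $p$.
   Context: $|E|$ denotes Lebesgue measure. $\|u\|_{L^p(\Omega)}$ may equal $+\infty$. For $p=1$ one has $1/p'=0$ and the inequality is understood as $\|u\|_{L^1(\Omega)}\geq c$. *)

(* Defs.v *)
From HB Require Import structures.
From mathcomp Require Import all_boot all_order all_algebra.
From mathcomp Require Import all_classical all_reals all_analysis.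

Set Implicit Arguments.
Unset Strict Implicit.
Unset Printing Implicit Defensive.
Import Order.TTheory GRing.Theory Num.Theory.
Import numFieldNormedType.Exports.

Local Open Scope classical_set_scope.
Local Open Scope ring_scope.

Definition measure_rV_display : measure_display.
Proof. exact. Qed.

Section measurable_rV.
Context {R : realType} (n : nat).

Definition rV_coord (i : 'I_n) (x : 'rV[R]_n) : measurableTypeR R := x ord0 i.

Let rV_set0 : g_sigma_preimage rV_coord set0.
Proof. exact: sigma_algebra0. Qed.

Let rV_setC A : g_sigma_preimage rV_coord A ->
  g_sigma_preimage rV_coord (~` A).
Proof. exact: sigma_algebraC. Qed.

Let rV_bigcup (F : (set 'rV[R]_n)^nat) :
  (forall i, g_sigma_preimage rV_coord (F i)) ->
  g_sigma_preimage rV_coord (\bigcup_i F i).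
Proof. exact: sigma_algebra_bigcup. Qed.

(* The Borel sigma-algebra of R^n, generated by the coordinate functions (see
   open_measurable_rV). *)
HB.instance Definition _ := @isMeasurable.Build measure_rV_display
  'rV[R]_n (g_sigma_preimage rV_coord) rV_set0 rV_setC rV_bigcup.

Lemma measurable_rV_coord i : measurable_fun [set: 'rV[R]_n] (rV_coord i).
Proof.
move=> _ Y mY; rewrite setTI; apply: sub_sigma_algebra => /=.
rewrite -bigcup_seq/=; exists i => /=; first by rewrite mem_index_enum.
by exists Y => //; rewrite setTI.
Qed.

Lemma measurable_fun_rV d (T : measurableType d) (f : T -> 'rV[R]_n) :
  (forall i, measurable_fun [set: T] (rV_coord i \o f)) ->
  measurable_fun [set: T] f.
Proof.
move=> mf.
have H : g_sigma_preimage (fun i => rV_coord i \o f) `<=` measurable.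
  apply: smallest_sub; first exact: sigma_algebra_measurable.
  move: rV_coord mf => c mf A; rewrite -bigcup_seq/= => -[i _ [B mB <-]].
  exact: mf.
move=> _ A mA; apply: H; rewrite g_sigma_preimage_comp.
by exists A.
Qed.

End measurable_rV.

Section lebesgue_rV.
Context {R : realType}.

Definition cons_rV n (p : measurableTypeR R * 'rV[R]_n) : 'rV[R]_n.+1 :=
  row_mx (const_mx p.1 : 'rV[R]_1) p.2.

Definition uncons_rV n (v : 'rV[R]_n.+1) : measurableTypeR R * 'rV[R]_n :=
  (v ord0 ord0, \row_j v ord0 (lift ord0 j)).

Lemma cons_rV0 n (p : measurableTypeR R * 'rV[R]_n) :
  cons_rV p ord0 ord0 = p.1.
Proof.
have -> : ord0 = lshift n (ord0 : 'I_1) by exact: val_inj.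
by rewrite (row_mxEl (const_mx p.1 : 'rV_1)) mxE.
Qed.

Lemma cons_rVS n (p : measurableTypeR R * 'rV[R]_n) j :
  cons_rV p ord0 (lift ord0 j) = p.2 ord0 j.
Proof.
have -> : lift ord0 j = rshift 1 j by exact: val_inj.
by rewrite (row_mxEr (const_mx p.1 : 'rV_1)).
Qed.

Lemma cons_rVK n : cancel (@cons_rV n) (@uncons_rV n).
Proof.
move=> [x v]; rewrite /uncons_rV cons_rV0; congr pair.
by apply/rowP => j; rewrite mxE cons_rVS.
Qed.

Lemma uncons_rVK n : cancel (@uncons_rV n) (@cons_rV n).
Proof.
move=> v; apply/rowP => i; have [->|[j ->]] : i = ord0 \/ exists j, i = lift ord0 j.
- by case: (unliftP ord0 i) => [j ->|->]; [right; exists j|left].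
- by rewrite cons_rV0.
- by rewrite cons_rVS mxE.
Qed.

Lemma measurable_cons_rV n : measurable_fun setT (@cons_rV n).
Proof.
apply: measurable_fun_rV => i.
have [->|[j ->]] : i = ord0 \/ exists j, i = lift ord0 j.
- by case: (unliftP ord0 i) => [j ->|->]; [right; exists j|left].
- rewrite (_ : _ \o _ = fst); first exact: measurable_fst.
  by apply/funext => p /=; rewrite /rV_coord cons_rV0.
- rewrite (_ : _ \o _ = rV_coord j \o snd); last first.
    by apply/funext => p /=; rewrite /rV_coord cons_rVS.
  by apply: measurableT_comp => //; exact: measurable_rV_coord.
Qed.

Lemma measurable_uncons_rV n : measurable_fun setT (@uncons_rV n).
Proof.
apply/measurable_fun_pairP; split; first exact: measurable_rV_coord.
apply: measurable_fun_rV => i.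
rewrite (_ : _ \o _ = rV_coord (lift ord0 i)); first exact: measurable_rV_coord.
by apply/funext => p /=; rewrite /rV_coord /= mxE.
Qed.

Section step.
Local Open Scope ereal_scope.
Context (n : nat) (mu : {sigma_finite_measure set 'rV[R]_n -> \bar R}).

Definition lebesgue_rV_step :=
  pushforward (lebesgue_measure \x mu) (@cons_rV n).

Let step0 : lebesgue_rV_step set0 = 0.
Proof. by rewrite /lebesgue_rV_step /pushforward preimage_set0 measure0. Qed.

Let step_ge0 A : 0 <= lebesgue_rV_step A.
Proof. exact: (measure_ge0 (lebesgue_measure \x mu)). Qed.

Let mcons A : measurable A -> measurable (@cons_rV n @^-1` A).
Proof. by move=> mA; rewrite -[X in measurable X]setTI; exact: measurable_cons_rV. Qed.

Let step_sigma_additive : semi_sigma_additive lebesgue_rV_step.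
Proof.
move=> F mF tF mUF; rewrite /lebesgue_rV_step /pushforward preimage_bigcup.
apply: measure_semi_sigma_additive.
- by move=> k; exact: mcons.
- apply/trivIsetP => /= i j _ _ ij; rewrite -preimage_setI.
  by move/trivIsetP : tF => /(_ _ _ _ _ ij) ->//; rewrite preimage_set0.
- by rewrite -preimage_bigcup; exact: mcons.
Qed.

HB.instance Definition _ := isMeasure.Build _ _ _
  lebesgue_rV_step step0 step_ge0 step_sigma_additive.

Let step_sigma_finite : sigma_finite [set: 'rV[R]_n.+1] lebesgue_rV_step.
Proof.
have /sigma_finiteP[F [FT ndF Foo]] := sigma_finiteT (@lebesgue_measure R).
have /sigma_finiteP[G [GT ndG Goo]] := sigma_finiteT mu.
exists (fun k => @uncons_rV n @^-1` (F k `*` G k)).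
  rewrite -preimage_bigcup (_ : \bigcup_k _ = setT) ?preimage_setT//.
  apply/seteqP; split => // -[x y] _.
  have [k _ Fkx] : (\bigcup_k F k) x by rewrite -FT.
  have [l _ Gly] : (\bigcup_k G k) y by rewrite -GT.
  exists (maxn k l) => //; split.
  - by move: x Fkx; exact/subsetPset/ndF/leq_maxl.
  - by move: y Gly; exact/subsetPset/ndG/leq_maxr.
move=> k; have [mF Fk] := Foo k; have [mG Gk] := Goo k; split.
  by rewrite -[X in measurable X]setTI; apply: measurable_uncons_rV => //;
    exact: measurableX.
rewrite /lebesgue_rV_step /pushforward (_ : _ @^-1` _ = F k `*` G k).
  by rewrite product_measure1E// lte_mul_pinfty// ge0_fin_numE.
by rewrite -comp_preimage (_ : _ \o _ = id)//; apply/funext/cons_rVK.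
Qed.

HB.instance Definition _ := Measure_isSigmaFinite.Build _ _ _
  lebesgue_rV_step step_sigma_finite.

End step.

Fixpoint lebesgue_rV n : {sigma_finite_measure set 'rV[R]_n -> \bar R} :=
  match n with
  | 0 => \d_(0 : 'rV[R]_0)
  | n'.+1 => lebesgue_rV_step (lebesgue_rV n')
  end.

Lemma lebesgue_rV_box n (a b : 'rV[R]_n) : (forall i, a ord0 i <= b ord0 i) ->
  lebesgue_rV n [set x | forall i, a ord0 i <= x ord0 i <= b ord0 i] =
  (\prod_(i < n) (b ord0 i - a ord0 i))%:E.
Proof.
elim: n a b => [|n IHn] a b ab.
  rewrite big_ord0 /= diracE mem_set//; by case.
pose tl (v : 'rV[R]_n.+1) : 'rV[R]_n := \row_j v ord0 (lift ord0 j).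
rewrite big_ord_recl.
transitivity ((lebesgue_measure \x lebesgue_rV n)%E (`[a ord0 ord0, b ord0 ord0] `*`
    [set x : 'rV[R]_n | forall i, tl a ord0 i <= x ord0 i <= tl b ord0 i])).
  congr (_ \x _)%E.
  apply/seteqP; split => [p /= H|p /= [H1 H2] i].
    split; first by have := H ord0; rewrite cons_rV0 in_itv.
    by move=> i; have := H (lift ord0 i); rewrite cons_rVS !mxE.
  have [->|[j ->]] : i = ord0 \/ exists j, i = lift ord0 j.
  - by case: (unliftP ord0 i) => [j ->|->]; [right; exists j|left].
  - by rewrite cons_rV0; move: H1; rewrite in_itv.
  - by rewrite cons_rVS; have := H2 j; rewrite !mxE.
rewrite product_measure1E//; last first.
  rewrite (_ : mkset _ = \bigcap_i
     (rV_coord i @^-1` `[tl a ord0 i, tl b ord0 i]%classic)); last first.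
    by apply/seteqP; split => [x H i _|x H i]; [|have := H i I]; rewrite /= in_itv/=.
  apply: fin_bigcap_measurable => // i _.
  by rewrite -[X in measurable X]setTI; apply: measurable_rV_coord.
rewrite IHn; last by move=> i; rewrite !mxE.
rewrite -[X in (X * _)%E]/(lebesgue_measure `[a ord0 ord0, b ord0 ord0]%classic).
rewrite lebesgue_measure_itv /= lte_fin; case: ltP => [_|ba].
  rewrite -EFinB -EFinM; congr (_ * _)%:E.
  by apply: eq_bigr => i _; rewrite !mxE.
have -> : b ord0 ord0 = a ord0 ord0 by apply/eqP; rewrite eq_le ba ab.
by rewrite mul0e subrr mul0r.
Qed.

End lebesgue_rV.
Arguments lebesgue_rV {R} n.

Section open_measurable_rV.
Context {R : realType} (n : nat).

Lemma open_measurable_rV (U : set 'rV[R]_n) : open U -> measurable U.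
Proof.
move=> oU.
pose box (ab : 'rV[rat]_n * 'rV[rat]_n) : set 'rV[R]_n :=
  [set x | forall i, ratr (ab.1 ord0 i) < x ord0 i < ratr (ab.2 ord0 i)].
have mbox ab : measurable (box ab).
  rewrite (_ : box ab = \bigcap_i (rV_coord i @^-1`
      `](ratr (ab.1 ord0 i)), (ratr (ab.2 ord0 i))[%classic)); last first.
    by apply/seteqP; split => [x H i _|x H i]; [|have := H i I]; rewrite /= in_itv/=.
  apply: fin_bigcap_measurable => // i _.
  by rewrite -[X in measurable X]setTI; apply: measurable_rV_coord.
have -> : U = \bigcup_(ab in [set ab | box ab `<=` U]) box ab.
  apply/seteqP; split => [x Ux|x [ab + ]]; last exact.
  have : nbhs x U by exact: open_nbhs_nbhs.
  rewrite -nbhs_ballE => -[e /= e0 eU].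
  have H1 i : {q : rat | x ord0 i - e < ratr q < x ord0 i}.
    apply: cid; have /rat_in_itvoo[q] : x ord0 i - e < x ord0 i.
      by rewrite ltrBlDr ltrDl.
    by rewrite in_itv/=; exists q.
  have H2 i : {q : rat | x ord0 i < ratr q < x ord0 i + e}.
    apply: cid; have /rat_in_itvoo[q] : x ord0 i < x ord0 i + e.
      by rewrite ltrDl.
    by rewrite in_itv/=; exists q.
  exists (\row_i sval (H1 i), \row_i sval (H2 i)) => /=.
    move=> y /= yb; apply: eU; split => // k i; rewrite (ord1 k).
    have := yb i; rewrite !mxE /ball /= => /andP[].
    have /andP[+ _] := svalP (H1 i); have /andP[_ +] := svalP (H2 i).
    move=> h1 h2 h3 h4; rewrite ltr_distlC.
    by rewrite (lt_trans h2 h3) (lt_trans h4 h1).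
  move=> i; rewrite !mxE.
  by have /andP[_ ->] := svalP (H1 i); have /andP[-> _] := svalP (H2 i).
rewrite bigcup_mkcond; apply: countable_bigcupT_measurable => // ab.
by case: ifP.
Qed.

End open_measurable_rV.

(* Functions on an open set Omega of R^n are represented by total functions on
   R^n, of which only the values on Omega are used. *)
Section smooth.
Context {R : realType} (n : nat).
Implicit Types (u : 'rV[R]_n -> R) (Omega : set 'rV[R]_n).

Definition partial (i : 'I_n) u : 'rV[R]_n -> R := 'D_(delta_mx ord0 i) u.

(* [:: i_1; ...; i_k] gives d_{i_1} ... d_{i_k} u *)
Definition iter_partial (s : seq 'I_n) u : 'rV[R]_n -> R :=
  foldr partial u s.

(* u is C^oo on Omega: partial derivatives of all orders exist and are
   continuous at every point of Omega. *)
Definition smooth_on Omega u := forall (s : seq 'I_n) x, Omega x ->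
  {for x, continuous (iter_partial s u)} /\
  forall i, derivable (iter_partial s u) x (delta_mx ord0 i).

Definition laplacian u : 'rV[R]_n -> R :=
  fun x => \sum_(i < n) partial i (partial i u) x.

(* L^p(Omega) norm, 1 <= p <= +oo, as the L^p norm over R^n of u extended by
   zero outside Omega *)
Definition Lp_norm_on Omega (p : \bar R) u : \bar R :=
  'N[lebesgue_rV n]_p[(EFin \o u) \_ Omega].

End smooth.

(* Main.v *)
(* Take a closed cube Q of radius r centred at z inside Omega and the polynomial
   phi(x) = prod_i (r^2 - (x_i - z_i)^2)^2, which vanishes to second order on
   the faces of Q. Each phi d_i u - u d_i phi vanishes on the faces orthogonal
   to e_i, so Green's identity on Q has no boundary term and gives
   int_Q phi <= int_Q phi (Delta u) = int_Q u (Delta phi) <= K int_Q |u|.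
   Hence int_Omega |u| >= c0 with c0 independent of u. Points where |u| < c
   contribute at most c |Omega|, so for c = c0 / (1 + |Omega|) the set
   E = {|u| >= c} already carries int_E |u| >= c, and Hoelder's inequality
   int_E |u| <= ||u||_p |E|^(1/p') concludes for all p at once. *)

Require Import Defs.
From mathcomp Require Import all_boot all_order all_algebra.
From mathcomp Require Import all_classical all_reals all_analysis.
From mathcomp Require Import measurable_realfun ess_sup_inf.
From mathcomp Require Import ring lra.
Import Order.TTheory GRing.Theory Num.Theory.
Import numFieldNormedType.Exports.
Local Open Scope classical_set_scope.
Local Open Scope ring_scope.

(** * Closed boxes: compactness, measurability, integrability of continuous functions *)

Definition box {R : realType} {n : nat} (a b : 'rV[R]_n) : set 'rV[R]_n :=
  [set x | forall i, a ord0 i <= x ord0 i <= b ord0 i].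

Section box.
Context {R : realType} {n : nat}.
Implicit Types (a b : 'rV[R]_n) (A : set 'rV[R]_n) (f : 'rV[R]_n -> R).

Lemma compact_box a b : compact (box a b).
Proof.
rewrite (_ : box a b = [set v | forall i, `[a ord0 i, b ord0 i]%classic (v ord0 i)]).
  apply: (@rV_compact _ _ (fun i => `[a ord0 i, b ord0 i]%classic)) => i.
  exact: segment_compact.
by apply/seteqP; split => x /= H i; have := H i; rewrite in_itv.
Qed.

Lemma measurable_box a b : measurable (box a b).
Proof.
rewrite (_ : box a b =
    \bigcap_i (rV_coord i @^-1` `[a ord0 i, b ord0 i]%classic)).
  apply: fin_bigcap_measurable => // i _.
  by rewrite -[X in measurable X]setTI; exact: measurable_rV_coord.
apply/seteqP; split => [x H i _|x H i]; first by rewrite /= in_itv; exact: H.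
by have := H i I; rewrite /= in_itv.
Qed.

(** Continuity is that of the total function at the points of [A], so every point of [A] mapped into
    an open interval is interior to the preimage. The preimage within [A] is thus [A] cut by an open
    set, whatever [f] does outside [A]. *)
Lemma continuous_at_measurable_fun A f : measurable A ->
  (forall x, A x -> {for x, continuous f}) ->
  measurable_fun A (f : 'rV[R]_n -> measurableTypeR R).
Proof.
move=> mA cf; apply: (measurability _ (RGenOpens.measurableE R)).
move=> _ [_ [a [b ->] <-]].
rewrite (_ : A `&` _ = A `&` (f @^-1` `]a, b[%classic)°).
  by apply: measurableI => //; apply: open_measurable_rV; exact: open_interior.
apply/seteqP; split => [x [Ax fx]|x [Ax /interior_subset]]; last by split.
by split => //; apply: (cf x Ax); apply: open_nbhs_nbhs; split.
Qed.

Lemma lebesgue_rV_box_lty a b : (forall i, a ord0 i <= b ord0 i) ->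
  (lebesgue_rV n (box a b) < +oo)%E.
Proof. by move=> ab; rewrite [ltLHS](lebesgue_rV_box ab) ltry. Qed.

Lemma bounded_box a b f : (forall x, box a b x -> {for x, continuous f}) ->
  exists M, forall x, box a b x -> `|f x| <= M.
Proof.
move=> cf; have : {within box a b, continuous f}.
  apply/subspace_continuousP => x Qx.
  by apply: cvg_within_filter; exact: cf.
move=> /continuous_compact /(_ (@compact_box a b))/compact_bounded[M [_ H]].
by exists (M + 1) => x Qx; apply: (H (M + 1)); [rewrite ltrDl|exists x].
Qed.

Lemma integrable_box a b f : (forall i, a ord0 i <= b ord0 i) ->
  (forall x, box a b x -> {for x, continuous f}) ->
  (lebesgue_rV n).-integrable (box a b) (EFin \o f).
Proof.
move=> ab cf; apply: measurable_bounded_integrable.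
- exact: measurable_box.
- exact: lebesgue_rV_box_lty.
- by apply: continuous_at_measurable_fun => //; exact: measurable_box.
have [M H] := bounded_box a b f cf; exists M; split; first exact: num_real.
by move=> y /ltW My x Qx; exact: le_trans (H x Qx) My.
Qed.

End box.

(** * Lines and slices through a first-coordinate splitting of R^(n+1) *)

Section slices.
Context {R : realType} {n : nat}.
Implicit Types (F : 'rV[R]_n.+1 -> R) (y : 'rV[R]_n).

(** Since [g] maps the line through [x] affinely onto the line through [g x], the two difference
    quotients are the same function of [h]. No chain rule is involved, so [F] may have a mere
    directional derivative. *)
Lemma is_derive_comp_line {U V W : normedModType R} (g : U -> V) (F : V -> W)
    (x w : U) (v : V) (d : W) :
  (forall h, g (h *: w + x) = h *: v + g x) ->
  is_derive (g x) v F d -> is_derive x w (F \o g) d.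
Proof.
move=> gE [dF Fd].
have E : (fun h => h^-1 *: (((F \o g) \o shift x) (h *: w) - (F \o g) x)) =
    (fun h => h^-1 *: ((F \o shift (g x)) (h *: v) - F (g x))).
  by apply/funext => h /=; rewrite gE.
by split; rewrite /derivable /derive E.
Qed.

Lemma cons_rVDl (t h : R) y :
  cons_rV (h + t, y) = h *: delta_mx ord0 ord0 + cons_rV (t, y).
Proof.
apply/rowP => i; rewrite [RHS]mxE [X in _ = X + _]mxE [X in _ = _ * X + _]mxE.
case: (unliftP ord0 i) => [j ->|->].
  by rewrite !cons_rVS eqxx /= mulr0 add0r.
by rewrite !cons_rV0 eqxx mulr1.
Qed.

Lemma cons_rVDr (t h : R) y j :
  cons_rV (t, h *: delta_mx ord0 j + y) =
  h *: delta_mx ord0 (lift ord0 j) + cons_rV (t, y).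
Proof.
apply/rowP => i; rewrite [RHS]mxE [X in _ = X + _]mxE [X in _ = _ * X + _]mxE.
case: (unliftP ord0 i) => [k ->|->].
  by rewrite !cons_rVS !mxE (inj_eq lift_inj).
by rewrite !cons_rV0 /= mulr0 add0r.
Qed.

Lemma continuous_cons_rVl y : continuous (fun t : R => cons_rV (t, y)).
Proof.
move=> t; apply/cvg_ballP => e e0.
apply: filterS (@nbhsx_ballx R R t e e0) => s ts; split => // i j.
rewrite (ord1 i); case: (unliftP ord0 j) => [k ->|->].
  by rewrite !cons_rVS; exact: ballxx.
by rewrite !cons_rV0.
Qed.

Lemma continuous_cons_rVr (t : R) : continuous (fun y => cons_rV (t, y)).
Proof.
move=> y; apply/(@cvg_ballP _ _ _ _ (nbhs_filter y)) => e e0.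
apply: (@filterS _ _ (nbhs_filter y) _ _ _ (nbhsx_ballx y e e0)) => z yz.
split => // i j.
rewrite (ord1 i); case: (unliftP ord0 j) => [k ->|->].
  by rewrite !cons_rVS; apply: yz.2.
by rewrite !cons_rV0; exact: ballxx.
Qed.

Lemma box_cons_rV (a b : 'rV[R]_n.+1) (p : measurableTypeR R * 'rV[R]_n) :
  box a b (cons_rV p) <->
  a ord0 ord0 <= p.1 <= b ord0 ord0 /\
  box (uncons_rV a).2 (uncons_rV b).2 p.2.
Proof.
split=> [H|[H1 H2] i].
  split; first by have := H ord0; rewrite cons_rV0.
  by move=> i; have := H (lift ord0 i); rewrite cons_rVS !mxE.
case: (unliftP ord0 i) => [k ->|->]; rewrite ?cons_rVS ?cons_rV0//.
by have := H2 k; rewrite !mxE.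
Qed.

End slices.

(** * Fundamental theorem of calculus and Fubini: integrals of partial derivatives over boxes *)

Lemma integral_derive_itv {R : realType} (a b : R) (f F : R -> R) : a < b ->
  (forall x, a <= x <= b -> {for x, continuous f}) ->
  (forall x, a <= x <= b -> is_derive x 1 F (f x)) ->
  F a = 0 -> F b = 0 ->
  (\int[lebesgue_measure]_(x in `[a, b]) (f x)%:E = 0)%E.
Proof.
move=> ab cf dF Fa Fb.
have cF x : a <= x <= b -> {for x, continuous F}.
  move=> /dF d; apply: differentiable_continuous; apply/derivable1_diffP.
  exact: ex_derive.
rewrite (continuous_FTC2 ab (F := F)) ?Fa ?Fb ?subee//.
- apply/subspace_continuousP => x /=; rewrite in_itv/= => xab.
  by apply: cvg_within_filter; exact: cf.
- split.
  + move=> x; rewrite in_itv/= => /andP[ax xb].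
    have d : is_derive x 1 F (f x) by apply: dF; rewrite (ltW ax) (ltW xb).
    exact: ex_derive.
  + by apply: cvg_at_right_filter; apply: cF; rewrite lexx ltW.
  + by apply: cvg_at_left_filter; apply: cF; rewrite lexx ltW.
- move=> x; rewrite in_itv/= => /andP[ax xb].
  have d : is_derive x 1 F (f x) by apply: dF; rewrite (ltW ax) (ltW xb).
  by rewrite derive1E; exact: derive_val.
Qed.

Section Fubini_rV.
Context {R : realType} {n : nat}.
Local Open Scope ereal_scope.
Local Notation leb := (@lebesgue_measure R).
Implicit Types f : 'rV[R]_n.+1 -> \bar R.

Lemma integrable_comp_cons_rV f : (lebesgue_rV n.+1).-integrable setT f ->
  (leb \x lebesgue_rV n).-integrable setT (f \o @cons_rV R n).
Proof.
move=> /integrableP[mf foo]; apply/integrableP; split.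
  by apply: measurableT_comp => //; exact: measurable_cons_rV.
apply: le_lt_trans foo; rewrite le_eqVlt; apply/orP; left; apply/eqP.
rewrite -[in LHS](preimage_setT (@cons_rV R n)).
rewrite -(ge0_integral_pushforward (@measurable_cons_rV R n) _ _
  (f := abse \o f))//.
- exact: measurableT_comp.
- by move=> y _; exact: abse_ge0.
Qed.

(** The measure on R^(n+1) is by construction the image of the product measure under [cons_rV]; this
    is the change of variables that opens the way to Fubini. *)
Lemma integral_comp_cons_rV f : (lebesgue_rV n.+1).-integrable setT f ->
  \int[lebesgue_rV n.+1]_x f x = \int[leb \x lebesgue_rV n]_p f (cons_rV p).
Proof.
move=> fi; rewrite -[in RHS](preimage_setT (@cons_rV R n)).
rewrite -(integral_pushforward (@measurable_cons_rV R n) _ _ (f := f))//.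
- exact: (measurable_int _ fi).
- by rewrite preimage_setT; exact: integrable_comp_cons_rV.
Qed.

End Fubini_rV.

(** Induction on the dimension, integrating first over a slice that contains the direction [i]:
    there the integral already vanishes, by the fundamental theorem of calculus or by the induction
    hypothesis. In dimension 0 there is no direction. *)
Lemma integral_partial_box {R : realType} {n : nat} (a b : 'rV[R]_n)
    (i : 'I_n) (f F : 'rV[R]_n -> R) :
  (forall j, a ord0 j < b ord0 j) ->
  (forall x, box a b x -> {for x, continuous f}) ->
  (forall x, box a b x -> is_derive x (delta_mx ord0 i) F (f x)) ->
  (forall x, box a b x -> x ord0 i = a ord0 i \/ x ord0 i = b ord0 i ->
    F x = 0) ->
  (\int[lebesgue_rV n]_(x in box a b) (f x)%:E = 0)%E.
Proof.
elim: n a b i f F => [a b []//|n IHn] a b i f F ab cf dF F0.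
(* Extension by zero lets both iterated integrals range over whole spaces. *)
have f_int : (lebesgue_rV n.+1).-integrable setT ((EFin \o f) \_ (box a b)).
  apply/(integrable_mkcond _ (measurable_box a b)).
  by apply: (@integrable_box _ _ _ _ f) => // j; exact: ltW.
rewrite integral_mkcond integral_comp_cons_rV//.
pose I := `[a ord0 ord0, b ord0 ord0]%classic.
pose Q := box (uncons_rV a).2 (uncons_rV b).2.
have boxP t y : box a b (cons_rV (t, y)) <-> I t /\ Q y.
  by rewrite /I /= in_itv; exact: box_cons_rV.
have patch0 t y : ~ (I t /\ Q y) ->
    ((EFin \o f) \_ (box a b)) (cons_rV (t, y)) = 0%E.
  by move=> H; rewrite patchE memNset// => /boxP.
have patch1 t y : I t -> Q y ->
    ((EFin \o f) \_ (box a b)) (cons_rV (t, y)) = (f (cons_rV (t, y)))%:E.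
  by move=> It Qy; rewrite patchE mem_set//; apply/boxP.
case: (unliftP ord0 i) dF F0 => [j ->|->] dF F0.
(* Direction [i] among the last [n]: fix the first coordinate [t] and apply the induction hypothesis
   to the slice [Q]. *)
- rewrite -integral12_prod_meas1; last exact: integrable_comp_cons_rV.
  rewrite /fubini_F /=; apply: integral0_eq => t _.
  have [It|It] := pselect (I t); last first.
    by apply: integral0_eq => y _; apply: patch0 => -[].
  transitivity (\int[lebesgue_rV n]_(y in Q) (f (cons_rV (t, y)))%:E)%E.
    rewrite [RHS]integral_mkcond; apply: eq_integral => y _.
    rewrite patchE; case: ifPn => [|] Qy.
      by apply: patch1 => //; exact: set_mem.
    by apply: patch0 => -[_ /mem_set]; apply/negP.
  apply: (IHn _ _ j _ (fun y => F (cons_rV (t, y)))).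
  + by move=> k; rewrite !mxE.
  + move=> y Qy; apply: (@continuous_comp _ _ _ (fun y => cons_rV (t, y)) f).
      exact: continuous_cons_rVr.
    by apply: cf; apply/boxP.
  + move=> y Qy.
    apply: (@is_derive_comp_line R _ _ _ (fun y => cons_rV (t, y)) F _ _
      (delta_mx ord0 (lift ord0 j))).
      by move=> h; exact: cons_rVDr.
    by apply: dF; apply/boxP.
  + move=> y Qy; rewrite !mxE => yj; apply: F0; first exact/boxP.
    by rewrite cons_rVS.
(* Direction [i] is the first one: fix the other coordinates [y] and integrate along the segment
   [I]. *)
- rewrite -integral21_prod_meas1; last exact: integrable_comp_cons_rV.
  rewrite /fubini_G /=; apply: integral0_eq => y _.
  have [Qy|Qy] := pselect (Q y); last first.
    by apply: integral0_eq => t _; apply: patch0 => -[].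
  transitivity (\int[lebesgue_measure]_(t in I) (f (cons_rV (t, y)))%:E)%E.
    rewrite [RHS]integral_mkcond; apply: eq_integral => t _.
    rewrite patchE; case: ifPn => [|] It.
      by apply: patch1 => //; exact: set_mem.
    by apply: patch0 => -[/mem_set]; rewrite (negbTE It).
  have It t : a ord0 ord0 <= t <= b ord0 ord0 -> I t by rewrite /I /= in_itv.
  apply: (@integral_derive_itv _ _ _ _ (fun t => F (cons_rV (t, y)))).
  + exact: ab.
  + move=> t /It tI.
    apply: (@continuous_comp _ _ _ (fun t : R => cons_rV (t, y)) f).
      exact: continuous_cons_rVl.
    by apply: cf; apply/boxP.
  + move=> t /It tI.
    apply: (@is_derive_comp_line R _ _ _ (fun t : R => cons_rV (t, y)) F _ _
      (delta_mx ord0 ord0)).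
      by move=> h; rewrite -cons_rVDl /GRing.scale /= mulr1.
    by apply: dF; apply/boxP.
  + apply: F0; last by rewrite cons_rV0; left.
    by apply/boxP; split => //; apply: It; rewrite lexx ltW.
  + apply: F0; last by rewrite cons_rV0; right.
    by apply/boxP; split => //; apply: It; rewrite lexx ltW.
Qed.

(** * The product polynomial, its derivatives, and Green's identity on a cube *)

Lemma is_derive_eq_line {R : realType} {V W : normedModType R} (F G : V -> W)
    (x v : V) (d : W) :
  (forall h, F (h *: v + x) = G (h *: v + x)) ->
  is_derive x v G d -> is_derive x v F d.
Proof.
move=> FG [dG Gd].
have FGx : F x = G x by have := FG 0; rewrite scale0r add0r.
have E : (fun h => h^-1 *: ((F \o shift x) (h *: v) - F x)) =
    (fun h => h^-1 *: ((G \o shift x) (h *: v) - G x)).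
  by apply/funext => h /=; rewrite FG FGx.
by split; rewrite /derivable /derive E.
Qed.

Lemma is_derive_coord {R : realType} {n : nat} (i : 'I_n) (x : 'rV[R]_n)
    (g : R -> R) (d : R) : is_derive (x ord0 i) 1 g d ->
  is_derive x (delta_mx ord0 i) (fun y : 'rV[R]_n => g (y ord0 i)) d.
Proof.
apply: (@is_derive_comp_line R _ _ _ (fun y : 'rV[R]_n => y ord0 i) g) => h.
by rewrite !mxE !eqxx.
Qed.

Section bump.
Context {R : realType} {n : nat}.
Variables (z : 'rV[R]_n) (r : R).
Implicit Types (x : 'rV[R]_n) (i : 'I_n) (t : R).

Definition bump1 i t : R := (r ^+ 2 - (t - z ord0 i) ^+ 2) ^+ 2.
Definition bump1' i t : R :=
  - 4 * ((t - z ord0 i) * (r ^+ 2 - (t - z ord0 i) ^+ 2)).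
Definition bump1'' i t : R := - 4 * (r ^+ 2 - 3 * (t - z ord0 i) ^+ 2).

Lemma is_derive_bump1 i t : is_derive t 1 (bump1 i) (bump1' i t).
Proof.
rewrite (_ : bump1 i = (cst (r ^+ 2) - (id - cst (z ord0 i)) ^+ 2) ^+ 2)//.
apply: is_derive_eq.
by rewrite /bump1' /GRing.scale /cst !fctE /=; ring.
Qed.

Lemma is_derive_bump1' i t : is_derive t 1 (bump1' i) (bump1'' i t).
Proof.
rewrite (_ : bump1' i = - 4 *: ((id - cst (z ord0 i)) *
  (cst (r ^+ 2) - (id - cst (z ord0 i)) ^+ 2)))//.
apply: is_derive_eq.
by rewrite /bump1'' /GRing.scale /cst !fctE /=; ring.
Qed.

Definition bump x : R := \prod_(j < n) bump1 j (x ord0 j).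
Definition bump_off i x : R := \prod_(j < n | j != i) bump1 j (x ord0 j).

Lemma bumpE i x : bump x = bump1 i (x ord0 i) * bump_off i x.
Proof. by rewrite /bump (bigD1 i). Qed.

(** [bump_off i] does not involve coordinate [i], so along the line in direction [i] it can be
    replaced by the constant [P], and only [g] gets differentiated. *)
Lemma is_derive_bump_off i x (g : R -> R) d : is_derive (x ord0 i) 1 g d ->
  is_derive x (delta_mx ord0 i) (fun y => g (y ord0 i) * bump_off i y)
    (d * bump_off i x).
Proof.
move=> dg; pose P := cst (bump_off i x) : 'rV[R]_n -> R.
have dG := is_derive_coord i x _ _ dg.
apply: (@is_derive_eq_line _ _ _ _ ((fun y : 'rV[R]_n => g (y ord0 i)) * P)).
  move=> h; congr (_ * _); apply: eq_bigr => j ji.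
  by rewrite !mxE (negbTE ji) andbF mulr0 add0r.
apply: is_derive_eq; rewrite /P /cst scaler0 add0r.
by rewrite /GRing.scale /= mulrC.
Qed.

Lemma continuous_bump1 i : continuous (bump1 i).
Proof.
move=> t; apply: differentiable_continuous; apply/derivable1_diffP.
by have d := is_derive_bump1 i t; exact: ex_derive.
Qed.

Lemma continuous_bump1'' i : continuous (bump1'' i).
Proof.
rewrite (_ : bump1'' i =
  - 4 *: (cst (r ^+ 2) - 3 *: (id - cst (z ord0 i)) ^+ 2))//.
move=> t; apply: differentiable_continuous; apply/derivable1_diffP.
exact: ex_derive.
Qed.

Lemma continuous_comp_coord i (g : R -> R) : continuous g ->
  continuous (fun x => g (x ord0 i)).
Proof.
move=> cg x; apply: (@continuous_comp _ _ _ (fun x : 'rV[R]_n => x ord0 i) g).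
  exact: coord_continuous.
exact: cg.
Qed.

Lemma continuous_bump_prod (P : pred 'I_n) :
  continuous (fun x => \prod_(j < n | P j) bump1 j (x ord0 j)).
Proof.
apply: (@continuous_big R 'I_n *%R 1 P (@mul_continuous R) _ (index_enum _)
  (fun j x => bump1 j (x ord0 j))) => i _.
exact/continuous_comp_coord/continuous_bump1.
Qed.

Definition cube (s : R) := box (z - const_mx s) (z + const_mx s).

Lemma cubeP s x : cube s x <-> forall i, `|x ord0 i - z ord0 i| <= s.
Proof.
by split=> H i; have := H i; rewrite !mxE ler_distl.
Qed.

Lemma cube_le s i : 0 <= s -> (z - const_mx s) ord0 i <= (z + const_mx s) ord0 i.
Proof. by move=> s0; rewrite !mxE; lra. Qed.

Lemma bump1_ge0 i t : 0 <= bump1 i t.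
Proof. exact: sqr_ge0. Qed.

Lemma bump_ge0 x : 0 <= bump x.
Proof. by apply: prodr_ge0 => i _; exact: bump1_ge0. Qed.

(** On the half-size cube each factor satisfies r^2 - (x_i - z_i)^2 >= 3r^2/4; the weaker bound
    r^2/2 suffices. *)
Lemma bump_ge x : 0 < r -> cube (r / 2) x -> ((r ^+ 2 / 2) ^+ 2) ^+ n <= bump x.
Proof.
move=> r0 /cubeP xz; rewrite -[X in _ ^+ X]card_ord -prodr_const.
apply: ler_prod => i _; rewrite sqr_ge0 /=.
have := xz i; rewrite ler_norml => /andP[lo hi].
rewrite ler_sqr ?nnegrE; last 2 first.
- by rewrite divr_ge0// sqr_ge0.
- by nra.
by nra.
Qed.

(** The Laplacian of [bump] in closed form, from which its continuity, hence its boundedness on a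
    cube, is read off. *)
Definition bump_laplacian x : R :=
  \sum_(i < n) bump1'' i (x ord0 i) * bump_off i x.

Lemma continuous_bump_partial2 i :
  continuous (fun x => bump1'' i (x ord0 i) * bump_off i x).
Proof.
move=> x.
have c1 : {for x, continuous (fun y : 'rV[R]_n => bump1'' i (y ord0 i))}.
  exact/continuous_comp_coord/continuous_bump1''.
have c2 : {for x, continuous (bump_off i)} by exact: continuous_bump_prod.
exact: (continuousM c1 c2).
Qed.

Lemma continuous_bump_laplacian : continuous bump_laplacian.
Proof.
rewrite /bump_laplacian.
apply: (@continuous_big R 'I_n +%R 0 xpredT (@add_continuous R) _
  (index_enum _) (fun j x => bump1'' j (x ord0 j) * bump_off j x)) => i _.
exact: continuous_bump_partial2.
Qed.

(** Green's identity is used in divergence form: the sum of the [f i] is phi (Delta u) - u (Delta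
    phi), and each [f i] has integral zero because it is the derivative of [F i] in direction
    [i]. *)
Lemma integral_bump_le u (K : R) : 0 < r -> smooth_on (cube r) u ->
  (forall x, cube r x -> 1 <= laplacian u x) ->
  (forall x, cube r x -> `|bump_laplacian x| <= K) ->
  (\int[lebesgue_rV n]_(x in cube r) (bump x)%:E <=
   K%:E * \int[lebesgue_rV n]_(x in cube r) `|u x|%:E)%E.
Proof.
move=> r0 su lu wK.
pose f i x := bump x * partial i (partial i u) x -
  u x * (bump1'' i (x ord0 i) * bump_off i x).
pose F i x := bump x * partial i u x -
  u x * (bump1' i (x ord0 i) * bump_off i x).
have rle i := cube_le r i (ltW r0).
have cbump : continuous bump by exact: continuous_bump_prod.
have cf i x : cube r x -> {for x, continuous (f i)}.
  move=> Qx; apply: continuousB; apply: continuousM.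
  - exact: cbump.
  - exact: (su [:: i; i] x Qx).1.
  - exact: (su [::] x Qx).1.
  - exact: continuous_bump_partial2.
have dF i x : cube r x -> is_derive x (delta_mx ord0 i) (F i) (f i x).
  move=> Qx.
  have d1 : is_derive x (delta_mx ord0 i) u (partial i u x).
    by split=> //; exact: (su [::] x Qx).2.
  have d2 : is_derive x (delta_mx ord0 i) (partial i u) (partial i (partial i u) x).
    by split=> //; exact: (su [:: i] x Qx).2.
  have d3 := is_derive_bump_off i x _ _ (is_derive_bump1 i (x ord0 i)).
  have d4 := is_derive_bump_off i x _ _ (is_derive_bump1' i (x ord0 i)).
  have E : bump = (fun y => bump1 i (y ord0 i) * bump_off i y).
    by apply/funext => y; exact: bumpE.
  rewrite /F /f E.
  (* The mixed terms, products of the first derivatives of [bump] and [u], cancel. *)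
  apply: is_derive_eq; rewrite /GRing.scale /=; ring.
have F0 i x : cube r x -> x ord0 i = (z - const_mx r) ord0 i \/
    x ord0 i = (z + const_mx r) ord0 i -> F i x = 0.
  move=> _ xi.
  (* This quantity is a factor of both [bump1] and [bump1'], so both terms of [F i] vanish on the
     two faces. *)
  have h0 : r ^+ 2 - (x ord0 i - z ord0 i) ^+ 2 = 0.
    by case: xi => ->; rewrite !mxE; ring.
  rewrite /F (bumpE i) /bump1 /bump1' h0; ring.
have if0 i : (\int[lebesgue_rV n]_(x in cube r) (f i x)%:E = 0)%E.
  apply: (@integral_partial_box _ _ _ _ i (f i) (F i)).
  - by move=> j; rewrite !mxE; lra.
  - exact: cf.
  - exact: F0.
have fint i : (lebesgue_rV n).-integrable (cube r) (EFin \o f i).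
  by apply: integrable_box => //; exact: cf.
have uint : (lebesgue_rV n).-integrable (cube r) (EFin \o (Num.norm \o u)).
  apply: integrable_norm; apply: integrable_box => // x Qx.
  exact: (su [::] x Qx).1.
have mQ : measurable (cube r) by exact: measurable_box.
rewrite -integralZl//.
(* Adding the [f i], whose integrals are zero, reduces the claim to a pointwise inequality of
   integrands. *)
have -> : (\int[lebesgue_rV n]_(x in cube r) (K%:E * `|u x|%:E) =
    \int[lebesgue_rV n]_(x in cube r)
      (K%:E * `|u x|%:E + \sum_(i < n) (f i x)%:E))%E.
  rewrite integralD//; last 2 first.
  - exact: (integrableZl mQ K uint).
  - apply: integrable_sum => // i _; exact: fint.
  by rewrite integral_sum// big1 ?adde0.
apply: le_integral => //.
- by apply: integrable_box => // x _; exact: cbump.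
- apply: integrableD => //; first exact: (integrableZl mQ K uint).
  by apply: integrable_sum => // i _; exact: fint.
(* Pointwise: phi <= phi (Delta u) = sum of the [f i] + u (Delta phi) <= sum of the [f i] + K
   |u|. *)
move=> x /set_mem Qx; rewrite sumEFin -EFinM -EFinD lee_fin.
rewrite sumrB -mulr_sumr -mulr_sumr -/(laplacian u x) -/(bump_laplacian x).
have := bump_ge0 x; have := lu x Qx; have := wK x Qx.
rewrite ler_norml => /andP[w1 w2] l1 b0.
have : u x * bump_laplacian x <= K * `|u x|.
  apply: le_trans (ler_norm _) _; rewrite normrM mulrC ler_wpM2r//.
  exact: wK.
nra.
Qed.

End bump.

(** * Hoelder's inequality against an indicator function, for all exponents *)

Section Lnorm_restriction.
Local Open Scope ereal_scope.
Context {d : measure_display} {T : measurableType d} {R : realType}.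
Variable mu : {measure set T -> \bar R}.

Lemma Lnorm_indic (E : set T) (q : R) : measurable E -> (0 < q)%R ->
  'N[mu]_q%:E[EFin \o \1_E] = mu E `^ q^-1.
Proof.
move=> mE q0; rewrite unlock; congr (_ `^ _).
rewrite -[E in RHS]setIT -integral_indic//; apply: eq_integral => x _.
rewrite /= indicE; case: (x \in E); rewrite ?normr1 ?powR1//.
by rewrite normr0 powR0// gt_eqF.
Qed.

(** For finite p > 1 this is Hoelder's inequality for [f] and the indicator of [E]. The endpoints
    are separate: monotonicity of the integral for p = 1, the essential bound on |f| for p = +oo. *)
Lemma Lnorm_ge_integral (f : T -> R) (E : set T) (p : \bar R) :
  measurable_fun [set: T] f -> measurable E -> 1 <= p ->
  \int[mu]_(x in E) `|f x|%:E <=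
    'N[mu]_p[EFin \o f] * mu E `^ fine (hoelder_conjugate p)^-1.
Proof.
move=> mf mE; have mfT : measurable_fun [set: T] (fun x => `|f x|%:E).
  by apply/measurable_EFinP; exact: measurableT_comp.
have mfE : measurable_fun E (fun x => `|f x|%:E) by exact: measurable_funS mfT.
case: p => [p p1|_|//].
- have [->|pn1] := eqVneq p 1%R.
    (* The conjugate of 1 is [+oo], with inverse 0, and any power with exponent 0 is 1, even when
       [mu E] is 0 or infinite. *)
    rewrite hoelder_conjugate1 invey/= poweRe0 mule1 Lnorm1.
    exact: ge0_subset_integral.
  have {}p1 : (1 < p)%R by rewrite lt_neqAle eq_sym pn1 -lee_fin.
  have p0 : (0 < p)%R by exact: lt_trans p1.
  have q0 : (0 < p / (p - 1))%R by rewrite divr_gt0// subr_gt0.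
  have pq : (p^-1 + (p / (p - 1))^-1 = 1)%R.
    by rewrite invf_div mulrBl divff ?gt_eqF// mul1r addrC subrK.
  have -> : hoelder_conjugate p%:E = (p / (p - 1))%:E.
    by rewrite /hoelder_conjugate /= eqe gt_eqF// -EFinD inver subr_eq0
      (negbTE pn1) -EFinM.
  rewrite inver gt_eqF//= -Lnorm_indic//.
  apply: le_trans (hoelder mu mf _ p0 q0 pq); last exact: measurable_indic.
  rewrite Lnorm1 integral_mkcond le_eqVlt; apply/orP; left; apply/eqP.
  apply: eq_integral => x _; rewrite patchE /= indicE.
  by case: ifPn => _; rewrite ?mulr1// mulr0 normr0.
- rewrite hoelder_conjugatey inve1 /= poweRe1//.
  have ae_le : {ae mu, forall x, E x -> `|f x|%:E <= 'N[mu]_+oo[EFin \o f]}.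
    (* The norm at [+oo] is the essential supremum only if the whole space has positive measure;
       otherwise the whole space is an exceptional null set. *)
    rewrite unlock; case: ifPn => [_|].
      by apply: filterS (ess_sup_ge mu (abse \o (EFin \o f))) => x.
    rewrite -leNgt => muT; exists setT; split => //.
    by apply/eqP; rewrite eq_le muT /=.
  rewrite -integral_cst//.
  by apply: ae_ge0_le_integral => // x _; exact: Lnorm_ge0.
Qed.

End Lnorm_restriction.

(** * The uniform lower bound on the L^1 norm *)

Lemma measurable_norm_continuous_at {R : realType} {n : nat}
    (A : set 'rV[R]_n) (u : 'rV[R]_n -> R) : measurable A ->
  (forall x, A x -> {for x, continuous u}) ->
  measurable_fun A (fun x => `|u x|%:E).
Proof.
move=> mA cu; apply/measurable_EFinP; apply: measurableT_comp => //.
exact: continuous_at_measurable_fun.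
Qed.

(** With Q the cube of radius [r] and Q' the one of radius r/2, the chain is m r^n <= int_Q' phi <=
    int_Q phi <= K int_Q |u| <= K int_Omega |u|. *)
Lemma L1_norm_lower_bound {R : realType} {n : nat} (Omega : set 'rV[R]_n) :
  Omega !=set0 -> open Omega ->
  exists2 c : R, 0 < c & forall u : 'rV[R]_n -> R,
    smooth_on Omega u -> (forall x, Omega x -> 1 <= laplacian u x) ->
    (c%:E <= \int[lebesgue_rV n]_(x in Omega) `|u x|%:E)%E.
Proof.
move=> [z Oz] oO.
have : nbhs z Omega by exact: open_nbhs_nbhs.
rewrite -nbhs_ballE => -[e /= e0 eO].
(* Halving [e] fits the closed cube into the open ball, which is a cube in the sup norm. *)
pose r := e / 2; have r0 : 0 < r by rewrite divr_gt0.
have QO : cube z r `<=` Omega.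
  move=> x /cubeP xz; apply: eO; split => // i j; rewrite (ord1 i) /ball /=.
  by rewrite distrC (le_lt_trans (xz j))// /r; lra.
have [M HM] : exists M, forall x, cube z r x -> `|bump_laplacian z r x| <= M.
  by apply: bounded_box => x _; exact: continuous_bump_laplacian.
(* The maximum with 1 makes [K] positive, so that it can be divided by. *)
pose K := Num.max M 1.
have K0 : 0 < K by rewrite lt_max ltr01 orbT.
pose m := ((r ^+ 2 / 2) ^+ 2) ^+ n.
have m0 : 0 < m by rewrite !exprn_gt0// divr_gt0// exprn_gt0.
(* Here [m] bounds [bump] from below on the half-size cube, whose side is [r] and volume r^n. *)
exists (K^-1 * (m * r ^+ n)).
  by rewrite mulr_gt0 ?invr_gt0// mulr_gt0// exprn_gt0.
move=> u su lu.
have mcube s : measurable (cube z s) by exact: measurable_box.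
have r2 : 0 <= r / 2 by lra.
have muO : measurable_fun Omega (fun x => `|u x|%:E).
  apply: measurable_norm_continuous_at; first exact: open_measurable_rV.
  by move=> x Ox; exact: (su [::] x Ox).1.
have mbump s : measurable_fun (cube z s) (fun x => (bump z r x)%:E).
  apply/measurable_EFinP; apply: continuous_at_measurable_fun => // x _.
  exact: continuous_bump_prod.
rewrite EFinM lee_pdivrMl//.
have [half_cube] : lebesgue_rV n (cube z (r / 2)) = (r ^+ n)%:E.
  rewrite (lebesgue_rV_box (fun i => cube_le z _ i r2)); congr _%:E.
  rewrite -[X in _ = _ ^+ X]card_ord -prodr_const; apply: eq_bigr => i _.
  by rewrite !mxE; lra.
apply: (@le_trans _ _ (\int[lebesgue_rV n]_(x in cube z (r / 2)) (bump z r x)%:E)%E).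
  rewrite EFinM -half_cube -integral_cst//.
  apply: ge0_le_integral => //.
  - by move=> x _; rewrite lee_fin ltW.
  - by move=> x Qx; rewrite lee_fin; exact: bump_ge.
apply: (@le_trans _ _ (\int[lebesgue_rV n]_(x in cube z r) (bump z r x)%:E)%E).
  apply: ge0_subset_integral => //.
  - by move=> x _; rewrite lee_fin bump_ge0.
  - move=> x /cubeP xz; apply/cubeP => i; apply: le_trans (xz i) _; lra.
apply: (@le_trans _ _ (K%:E * \int[lebesgue_rV n]_(x in cube z r) `|u x|%:E)%E).
  apply: integral_bump_le => //.
  - by move=> s x Qx; apply: su; exact: QO.
  - by move=> x Qx; apply: lu; exact: QO.
  - by move=> x Qx; rewrite le_max HM.
rewrite lee_pmul2l//.
apply: ge0_subset_integral => //; exact: open_measurable_rV.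
Qed.

(** The norm on row vectors is the sup norm, so a bounded set lies in a box centred at 0. *)
Lemma lebesgue_rV_bounded_lty {R : realType} {n : nat} (A : set 'rV[R]_n) :
  measurable A -> bounded_set A -> (lebesgue_rV n A < +oo)%E.
Proof.
move=> mA [M [_ HM]].
pose b : 'rV[R]_n := const_mx (`|M| + 1).
have bb i : (- b) ord0 i <= b ord0 i.
  by rewrite !mxE; have := normr_ge0 M; lra.
apply: le_lt_trans (lebesgue_rV_box_lty _ _ bb).
apply: le_measure; rewrite ?inE//; first exact: measurable_box.
move=> x Ax i; rewrite !mxE -ler_norml.
have Mx : `|x| <= `|M| + 1.
  by apply: HM => //; have := ler_norm M; lra.
apply: le_trans Mx; rewrite [leRHS]/Num.norm /= mx_normrE.
exact: (le_bigmax _ (fun ij => `|x ij.1 ij.2|) (ord0, i)).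
Qed.

(** * From the L^1 bound to all exponents at once *)

Theorem proposition1p1 (R : realType) (n : nat) (Omega : set 'rV[R]_n)
    (Omega_neq0 : Omega !=set0) (Omega_open : open Omega)
    (Omega_bounded : bounded_set Omega) :
  exists c : R, 0 < c /\
    forall u : 'rV[R]_n -> R,
      smooth_on Omega u ->
      (forall x, Omega x -> 1 <= laplacian u x) ->
      forall p : \bar R, (1 <= p)%E ->
        (c%:E <= Lp_norm_on Omega p u *
           lebesgue_rV n [set x | Omega x /\ (c <= `|u x|)%R]
             `^ fine (hoelder_conjugate p)^-1)%E.
Proof.
have [c0 c00 Hc0] := L1_norm_lower_bound Omega Omega_neq0 Omega_open.
have mO : measurable Omega := open_measurable_rV Omega_open.
have Ofin := lebesgue_rV_bounded_lty Omega mO Omega_bounded.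
pose V := fine (lebesgue_rV n Omega).
have V0 : 0 <= V by apply: fine_ge0; exact: measure_ge0.
(* Chosen so that c + c V = c0. *)
pose c := c0 / (1 + V).
have c_gt0 : 0 < c by rewrite divr_gt0// ltr_wpDr.
exists c; split => // u su lu p p1.
set E := [set x | _].
have cu x : Omega x -> {for x, continuous u}.
  by move=> Ox; exact: (su [::] x Ox).1.
have muO := measurable_norm_continuous_at Omega u mO cu.
have EO : E `<=` Omega by move=> x [].
have mE : measurable E.
  rewrite (_ : E = Omega `&` (fun x => `|u x|%:E) @^-1` `[c%:E, +oo[).
    by apply: muO => //; exact: emeasurable_itv.
  apply/seteqP; split => x /=; rewrite in_itv /= andbT lee_fin//.
have cE : (c%:E <= \int[lebesgue_rV n]_(x in E) `|u x|%:E)%E.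
  have := Hc0 u su lu.
  have mD : measurable (Omega `\` E) by exact: measurableD.
  (* Split Omega into [E] and its complement, where |u| < c contributes at most c V. *)
  rewrite -[in X in (_ <= X)%E](setDUK EO) ge0_integral_setU//; last 2 first.
  - by rewrite setDUK.
  - by apply/disj_set2P; rewrite setDE setICA setICr setI0.
  have le_cV : (\int[lebesgue_rV n]_(x in Omega `\` E) `|u x|%:E <=
      (c * V)%:E)%E.
    apply: (@le_trans _ _ (\int[lebesgue_rV n]_(x in Omega `\` E) cst c%:E x)%E).
      apply: ge0_le_integral => //.
      - by apply: measurable_funS muO => // x [].
      - move=> x [Ox nE]; rewrite lee_fin leNgt; apply/negP => /ltW cx.
        by apply: nE; split.
    rewrite integral_cst// (EFinM c V) lee_pmul2l//.
    rewrite /V fineK ?ge0_fin_numE//; apply: le_measure; rewrite ?inE//.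
  (* The term c V is finite and may be added to both sides; the left one then becomes c0. *)
  move=> c0le; rewrite -(leeD2rE (x := (c * V)%:E))//.
  apply: le_trans (le_trans c0le _); last exact: leeD2l.
  rewrite -EFinD lee_fin -[X in X + _]mulr1 -mulrDr /c divfK//.
  by rewrite gt_eqF// ltr_wpDr.
apply: (le_trans cE); rewrite /Lp_norm_on restrict_EFin.
(* Hoelder's inequality is applied to the extension of [u] by zero, which is measurable on the whole
   space and agrees with [u] on [E]. *)
have mu0 : measurable_fun [set: 'rV[R]_n] (u \_ Omega).
  apply/(measurable_restrictT _ mO).
  exact: continuous_at_measurable_fun.
apply: le_trans (Lnorm_ge_integral (lebesgue_rV n) _ E p mu0 mE p1).
rewrite le_eqVlt; apply/orP; left; apply/eqP.
apply: eq_integral => x /set_mem [Ox _].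
by rewrite patchE mem_set.
Qed.
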